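(* Let $K$ be a field with $\operatorname{char} K\neq 2$, let $\Gamma$ be a finite quiver without oriented cycles with $|\Gamma_0|\geq 2$, let $\rho$ be a set of relations on $\Gamma$ over $K$, and let $\Lambda=K(\Gamma,\rho)$. If there is no path $p$ in $\Gamma$ with length more than one, then every Jordan derivation on the generalized one-point extension algebra $E(\Lambda)$ is the sum of a derivation and an anti-derivation of $E(\Lambda)$.
   Context: Quivers and path algebras. A finite quiver $\Gamma=(\Gamma_0,\Gamma_1)$ has finite vertex set $\Gamma_0$ and finite arrow set $\Gamma_1$; an arrow $\alpha$ from $i$ to $j$ has $s(\alpha)=i$, $e(\alpha)=j$. A nontrivial path is a sequence $p=\alpha_n\cdots\alpha_1$ of arrows with $e(\alpha_m)=s(\alpha_{m+1})$ for $1\le m<n$; $s(p)=s(\alpha_1)$, $e(p)=e(\alpha_n)$, and its length is $n$. Each vertex $i$ gives a trivial path $e_i$ of length $0$ with $s(e_i)=e(e_i)=i$. An oriented cycle is a nontrivial path $p$ with $s(p)=e(p)$. In the path algebra $K\Gamma$ the product $xy$ of paths is the concatenation ($y$ first, then $x$) if $e(y)=s(x)$, and $0$ otherwise. A relation is a $K$-linear combination of paths of length at least $2$ having a common start and a common end. For a set $\rho$ of relations, $K(\Gamma,\rho)=K\Gamma/\langle\rho\rangle$, where $\langle\rho\rangle$ is the two-sided ideal generated by $\rho$. Generalized one-point extension. Let $\Gamma^{\ast}$ be the quiver with vertex set $\Gamma_0$ and arrows $\Gamma_1^{\ast}=\{\alpha^{\ast}:i\to j\mid \alpha:j\to i \text{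 in }\Gamma_1\}$. For a path $p=\alpha_n\cdots\alpha_1$ in $\Gamma$ put $p^{\ast}=\alpha_1^{\ast}\cdots\alpha_n^{\ast}$, and extend linearly, so that $\rho^{\ast}=\{\sigma^{\ast}\mid\sigma\in\rho\}$. For $\Gamma$ finite without oriented cycles and $|\Gamma_0|\ge 2$, the generalized one-point extension algebra $E(\Lambda)$ of $\Lambda=K(\Gamma,\rho)$ is the path algebra of the quiver $(\Gamma_0,\Gamma_1\cup\Gamma_1^{\ast})$ modulo the relations $\rho\cup\rho^{\ast}\cup\{\alpha\beta^{\ast}\mid\alpha,\beta\in\Gamma_1\}\cup\{\alpha^{\ast}\beta\mid\alpha,\beta\in\Gamma_1\}$. Derivations. For a $K$-algebra $\mathcal{A}$ put $a\circ b=ab+ba$. A $K$-linear map $\Theta:\mathcal{A}\to\mathcal{A}$ is a derivation if $\Theta(ab)=\Theta(a)b+a\Theta(b)$ for all $a,b$; an anti-derivation if $\Theta(ab)=\Theta(b)a+b\Theta(a)$ for all $a,b$; and a Jordan derivation if $\Theta(a\circ b)=\Theta(a)\circ b+a\circ\Theta(b)$ for all $a,b$. *)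

(* Defs.v *)
From HB Require Import structures.
From mathcomp Require Import all_boot all_algebra.
From mathcomp Require Import generic_quotient ring_quotient finmap boolp.
From mathcomp.multinomials Require Import monalg.

Set Implicit Arguments.
Unset Strict Implicit.
Unset Printing Implicit Defensive.

Import GRing.Theory.

Local Open Scope ring_scope.
Local Open Scope quotient_scope.

Section Derivations.
Variables (K : pzRingType) (A : algType K).

Definition jordan_mul (a b : A) : A := a * b + b * a.

Definition is_derivation (T : {linear A -> A}) : Prop :=
  forall a b : A, T (a * b) = T a * b + a * T b.

Definition is_antiderivation (T : {linear A -> A}) : Prop :=
  forall a b : A, T (a * b) = T b * a + b * T a.

Definition is_jordan_derivation (T : {linear A -> A}) : Prop :=
  forall a b : A,
    T (jordan_mul a b) = jordan_mul (T a) b + jordan_mul a (T b).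

End Derivations.

Section QuotientAlgebra.
Variables (K : pzRingType) (A : algType K) (S : A -> Prop).

Inductive gen_ideal : A -> Prop :=
| gen_ideal0 : gen_ideal 0
| gen_idealD x y : gen_ideal x -> gen_ideal y -> gen_ideal (x + y)
| gen_ideal_mul a r b : S r -> gen_ideal (a * r * b).

Lemma gen_idealMl a x : gen_ideal x -> gen_ideal (a * x).
Proof.
elim=> [|u v _ hu _ hv|c r b Sr].
- by rewrite mulr0; exact: gen_ideal0.
- by rewrite mulrDr; exact: gen_idealD.
- by rewrite !mulrA; exact: gen_ideal_mul.
Qed.

Lemma gen_idealMr a x : gen_ideal x -> gen_ideal (x * a).
Proof.
elim=> [|u v _ hu _ hv|c r b Sr].
- by rewrite mul0r; exact: gen_ideal0.
- by rewrite mulrDl; exact: gen_idealD.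
- by rewrite -mulrA; exact: gen_ideal_mul.
Qed.

Lemma gen_ideal_sub r : S r -> gen_ideal r.
Proof. by move=> /(gen_ideal_mul 1 1); rewrite mul1r mulr1. Qed.

Lemma gen_idealN x : gen_ideal x -> gen_ideal (- x).
Proof. by rewrite -mulN1r; exact: gen_idealMl. Qed.

Lemma gen_idealZ k x : gen_ideal x -> gen_ideal (k *: x).
Proof. by rewrite -[x in k *: x]mul1r scalerAl; exact: gen_idealMl. Qed.

Definition in_ideal : A -> bool := fun x => `[< gen_ideal x >].

Lemma in_idealP x : reflect (gen_ideal x) (x \in in_ideal).
Proof. exact: asboolP. Qed.

Lemma in_ideal_zmod_closed : zmod_closed in_ideal.
Proof.
split=> [|x y /in_idealP hx /in_idealP hy]; apply/in_idealP.
  exact: gen_ideal0.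
by apply: gen_idealD => //; exact: gen_idealN.
Qed.

HB.instance Definition _ := GRing.isZmodClosed.Build A in_ideal
  in_ideal_zmod_closed.

Definition ideal : zmodClosed A := GRing.ZmodClosed.clone A in_ideal _.

Definition quot_alg (properS : ~ gen_ideal 1) : Type := Quotient.quot ideal.

Variable properS : ~ gen_ideal 1.
Local Notation Q := (quot_alg properS).

HB.instance Definition _ := GRing.Zmodule.on Q.

Definition quot_pi (x : A) : Q := \pi_(Quotient.quot ideal) x.

Definition quot_repr (x : Q) : A := repr (x : Quotient.quot ideal).

Lemma quot_reprK : cancel quot_repr quot_pi.
Proof. by move=> x; exact: (reprK (x : Quotient.quot ideal)). Qed.

Lemma quot_piP x y : quot_pi x = quot_pi y <-> gen_ideal (x - y).
Proof.
split=> h.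
  by apply/in_idealP; rewrite Quotient.idealrBE; apply/eqP.
by apply/eqP; rewrite -Quotient.idealrBE; apply/in_idealP.
Qed.

Lemma quot_piB : {morph quot_pi : x y / x - y}.
Proof.
exact: (raddfB (\pi_(Quotient.quot ideal) : {additive A -> _})).
Qed.

HB.instance Definition _ := GRing.isZmodMorphism.Build A Q quot_pi
  quot_piB.

Definition quot_one : Q := quot_pi 1.
Definition quot_mul (x y : Q) : Q :=
  quot_pi (quot_repr x * quot_repr y).
Definition quot_scale (k : K) (x : Q) : Q :=
  quot_pi (k *: quot_repr x).

Lemma gen_ideal_repr x : gen_ideal (quot_repr (quot_pi x) - x).
Proof. by apply/quot_piP; rewrite quot_reprK. Qed.

Lemma quot_mul_pi x y : quot_mul (quot_pi x) (quot_pi y) = quot_pi (x * y).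
Proof.
apply/quot_piP; set x' := quot_repr _; set y' := quot_repr _.
have -> : x' * y' - x * y = (x' - x) * y' + x * (y' - y).
  by rewrite mulrBl mulrBr addrA subrK.
apply: gen_idealD; first exact/gen_idealMr/gen_ideal_repr.
exact/gen_idealMl/gen_ideal_repr.
Qed.

Lemma quot_scale_pi k x : quot_scale k (quot_pi x) = quot_pi (k *: x).
Proof. by apply/quot_piP; rewrite -scalerBr; exact/gen_idealZ/gen_ideal_repr. Qed.

Lemma quot_ind (P : Q -> Prop) : (forall x, P (quot_pi x)) -> forall x, P x.
Proof. by move=> h x; rewrite -[x]quot_reprK. Qed.

Fact quot_mulA : associative quot_mul.
Proof.
by do 3 elim/quot_ind => ?; rewrite !quot_mul_pi mulrA.
Qed.

Fact quot_mul1 : left_id quot_one quot_mul.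
Proof. by elim/quot_ind => ?; rewrite quot_mul_pi mul1r. Qed.

Fact quot_mulr1 : right_id quot_one quot_mul.
Proof. by elim/quot_ind => ?; rewrite quot_mul_pi mulr1. Qed.

Fact quot_mulDl : left_distributive quot_mul +%R.
Proof.
by do 3 elim/quot_ind => ?; rewrite -raddfD !quot_mul_pi -raddfD mulrDl.
Qed.

Fact quot_mulDr : right_distributive quot_mul +%R.
Proof.
by do 3 elim/quot_ind => ?; rewrite -raddfD !quot_mul_pi -raddfD mulrDr.
Qed.

Fact quot_one_neq0 : quot_one != 0.
Proof.
apply/eqP; rewrite -(raddf0 quot_pi) => /quot_piP.
by rewrite subr0; exact: properS.
Qed.

HB.instance Definition _ := GRing.Zmodule_isNzRing.Build Q
  quot_mulA quot_mul1 quot_mulr1 quot_mulDl quot_mulDr quot_one_neq0.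

Fact quot_scaleA a b v : quot_scale a (quot_scale b v) = quot_scale (a * b) v.
Proof. by elim/quot_ind: v => ?; rewrite !quot_scale_pi scalerA. Qed.

Fact quot_scale1 : left_id 1 quot_scale.
Proof. by elim/quot_ind => ?; rewrite quot_scale_pi scale1r. Qed.

Fact quot_scaleDr : right_distributive quot_scale +%R.
Proof.
by move=> k; do 2 elim/quot_ind => ?; rewrite -raddfD !quot_scale_pi -raddfD scalerDr.
Qed.

Fact quot_scaleDl v : {morph quot_scale^~ v : a b / a + b}.
Proof. by elim/quot_ind: v => ? a b; rewrite !quot_scale_pi -raddfD scalerDl. Qed.

HB.instance Definition _ := GRing.Zmodule_isLmodule.Build K Q
  quot_scaleA quot_scale1 quot_scaleDr quot_scaleDl.

Lemma quot_piM : {morph quot_pi : x y / x * y}.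
Proof. by move=> x y; rewrite -quot_mul_pi. Qed.

Lemma quot_pi1 : quot_pi 1 = 1.
Proof. by []. Qed.

Lemma quot_piZ k x : quot_pi (k *: x) = k *: quot_pi x.
Proof. by rewrite -quot_scale_pi. Qed.

Fact quot_scaleAl (k : K) (x y : Q) : k *: (x * y) = (k *: x) * y.
Proof.
elim/quot_ind: x => x; elim/quot_ind: y => y.
by rewrite -(quot_piZ k x) -!quot_piM -(quot_piZ k (x * y)) scalerAl.
Qed.

Fact quot_scaleAr (k : K) (x y : Q) : k *: (x * y) = x * (k *: y).
Proof.
elim/quot_ind: x => x; elim/quot_ind: y => y.
by rewrite -(quot_piZ k y) -!quot_piM -(quot_piZ k (x * y)) scalerAr.
Qed.

HB.instance Definition _ := GRing.Lmodule_isLalgebra.Build K Q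
  quot_scaleAl.
HB.instance Definition _ := GRing.Lalgebra_isAlgebra.Build K Q
  quot_scaleAr.

End QuotientAlgebra.

(* Nonemptiness makes the path algebra a nonzero ring, as [algType] requires. *)
Record quiver := Quiver {
  vertex : finType;
  arrow : finType;
  source : arrow -> vertex;
  target : arrow -> vertex;
  vertex_gt0 : (0 < #|vertex|)%N
}.

Section Paths.
Variable G : quiver.

Fixpoint is_walk (i : vertex G) (w : seq (arrow G)) : bool :=
  if w is a :: w' then (source a == i) && is_walk (target a) w' else true.

Definition walk_end (i : vertex G) (w : seq (arrow G)) : vertex G :=
  last i (map (@target G) w).

(* A path is its starting vertex together with its arrows in the order in     *)
(* which they are traversed: alpha_n ... alpha_1 is stored as                 *)
(* (s(alpha_1), [:: alpha_1; ...; alpha_n]) and e_i as (i, [::]).             *)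
Record qpath := QPath {
  path_val : vertex G * seq (arrow G);
  path_valid : is_walk path_val.1 path_val.2
}.

HB.instance Definition _ := [isSub for path_val].
HB.instance Definition _ := [Choice of qpath by <:].

Definition path_arrows (p : qpath) : seq (arrow G) := (path_val p).2.
Definition path_start (p : qpath) : vertex G := (path_val p).1.
Definition path_end (p : qpath) : vertex G := walk_end (path_start p) (path_arrows p).
Definition path_length (p : qpath) : nat := size (path_arrows p).

Definition triv_path (i : vertex G) : qpath := @QPath (i, [::]) isT.

Fact arrow_path_valid (a : arrow G) : is_walk (source a) [:: a].
Proof. by rewrite /= eqxx. Qed.

Definition arrow_path (a : arrow G) : qpath :=
  @QPath (source a, [:: a]) (arrow_path_valid a).

Lemma is_walk_cat i w1 w2 :
  is_walk i (w1 ++ w2) = is_walk i w1 && is_walk (walk_end i w1) w2.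
Proof.
by elim: w1 i => //= a w1 IH i; rewrite IH andbA /walk_end /=.
Qed.

Lemma walk_end_cat i w1 w2 :
  walk_end i (w1 ++ w2) = walk_end (walk_end i w1) w2.
Proof. by rewrite /walk_end map_cat last_cat. Qed.

Lemma path_inj p q :
  path_start p = path_start q -> path_arrows p = path_arrows q -> p = q.
Proof.
by move=> h1 h2; apply/val_inj; apply: (injective_projections _ _ h1 h2).
Qed.

(* The concatenation xy ("y first, then x"), [None] when e(y) <> s(x); the     *)
(* partial constructor [insub] always succeeds here, see [pathM_some].         *)
Definition pathM (x y : qpath) : option qpath :=
  if path_end y == path_start x
  then insub (path_start y, path_arrows y ++ path_arrows x)
  else None.

Lemma pathM_some x y z : pathM x y = Some z <->
  [/\ path_end y = path_start x, path_start z = path_start y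
    & path_arrows z = path_arrows y ++ path_arrows x].
Proof.
rewrite /pathM; split; last first.
  case=> /eqP -> hs ha; rewrite -hs -ha.
  by rewrite /path_start /path_arrows -surjective_pairing (valK z).
case: eqP => // e; case: insubP => // u _ hu [<-]; split=> //.
  by rewrite /path_start -[path_val u]/(val u) hu.
by rewrite /path_arrows -[path_val u]/(val u) hu.
Qed.

Lemma pathM_def x y : path_end y = path_start x -> exists z, pathM x y = Some z.
Proof.
move=> e.
have v : is_walk (path_start y) (path_arrows y ++ path_arrows x).
  rewrite is_walk_cat; apply/andP; split; first exact: (path_valid y).
  by rewrite -/(path_end y) e; exact: (path_valid x).
by exists (@QPath (path_start y, path_arrows y ++ path_arrows x) v); apply/pathM_some.
Qed.

Lemma pathM_none x y : path_end y <> path_start x -> pathM x y = None.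
Proof. by rewrite /pathM => /eqP /negPf ->. Qed.

Lemma pathM_end x y z : pathM x y = Some z -> path_end z = path_end x.
Proof.
by case/pathM_some=> e hs ha; rewrite /path_end hs ha walk_end_cat -/(path_end y) e.
Qed.

Lemma pathMA x y z :
  obind (pathM x) (pathM y z) = obind (fun u => pathM u z) (pathM x y).
Proof.
have [e1|n1] := path_end z =P path_start y; last first.
  rewrite (pathM_none n1) /=; case h: (pathM x y) => [u|] //=.
  by rewrite pathM_none //; case/pathM_some: h => _ -> _.
have [u hu] := pathM_def e1; rewrite hu /=.
have [e2|n2] := path_end y =P path_start x; last first.
  by rewrite (pathM_none n2) /= pathM_none // (pathM_end hu).
have [v hv] := pathM_def e2; rewrite hv /=.
have e3 : path_end u = path_start x by rewrite (pathM_end hu).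
have [w hw] := pathM_def e3; rewrite hw; apply/esym/pathM_some.
case/pathM_some: hu => _ su au; case/pathM_some: hv => _ sv av.
case/pathM_some: hw => _ sw aw.
by split; rewrite ?sv // ?sw // aw au av catA.
Qed.

Lemma pathM_triv_l i x :
  pathM (triv_path i) x = if path_end x == i then Some x else None.
Proof.
case: eqP => [e|n]; last exact: pathM_none.
by apply/pathM_some; split=> //; rewrite cats0.
Qed.

Lemma pathM_triv_r i x :
  pathM x (triv_path i) = if i == path_start x then Some x else None.
Proof.
by case: eqP => [e|n]; [apply/pathM_some | exact: pathM_none].
Qed.

End Paths.

Lemma malg_lin_expansion (K : fieldType) (T : choiceType) (x : {malg K[T]}) :
  x = \sum_(p <- msupp x) x@_p *: << p >>.
Proof.
rewrite [LHS]monalgE; apply: eq_bigr => p _; apply/malgP => q.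
by rewrite mcoeffZ (mcoeffU p (x@_p)) (mcoeffU p 1) mulr_natr.
Qed.

Definition path_algebra (K : fieldType) (G : quiver) : Type := {malg K[qpath G]}.

HB.instance Definition _ (K : fieldType) (G : quiver) :=
  GRing.Lmodule.on (path_algebra K G).

HB.lock Definition pathA (K : fieldType) (G : quiver) (p : qpath G) :
  path_algebra K G := << p >>.

Arguments pathA K {G} p.

Definition opathA (K : fieldType) (G : quiver) (p : option (qpath G)) :
  path_algebra K G := oapp (@pathA K G) 0 p.

HB.lock Definition palg_mul (K : fieldType) (G : quiver)
    (x y : path_algebra K G) : path_algebra K G :=
  \sum_(p <- msupp x) \sum_(q <- msupp y) (x@_p * y@_q) *: opathA K (pathM p q).

Arguments palg_mul {K G} x y.

Section PathAlgebra.
Variables (K : fieldType) (G : quiver).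

Local Notation path_algebra := (path_algebra K G).
Local Notation pathA := (@pathA K G).
Local Notation opathA := (@opathA K G).
Local Notation palg_mul := (@palg_mul K G).

Definition palg_one : path_algebra := \sum_(i : vertex G) pathA (triv_path i).

Lemma pathAE p : pathA p = << p >>.
Proof. by rewrite unlock. Qed.

Lemma palg_mulE x y : palg_mul x y =
  \sum_(p <- msupp x) \sum_(q <- msupp y) (x@_p * y@_q) *: opathA (pathM p q).
Proof. by rewrite unlock. Qed.

Lemma pathA_coef p q : (pathA p)@_q = (p == q)%:R.
Proof. by rewrite pathAE mcoeffU. Qed.

Lemma path_algebraE (x : path_algebra) :
  x = \sum_(p <- msupp x) x@_p *: pathA p.
Proof.
rewrite [LHS]malg_lin_expansion; apply: eq_bigr => p _; by rewrite pathAE.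
Qed.

Lemma palg_mulw (d1 d2 : {fset qpath G}) x y :
  (msupp x `<=` d1)%fset -> (msupp y `<=` d2)%fset ->
  palg_mul x y =
    \sum_(p <- d1) \sum_(q <- d2) (x@_p * y@_q) *: opathA (pathM p q).
Proof.
move=> le1 le2; rewrite palg_mulE (big_fset_incl _ le1) /=.
  apply/eq_bigr => p _; apply/big_fset_incl => // q _ /mcoeff_outdom ->.
  by rewrite mulr0 scale0r.
by move=> p _ /mcoeff_outdom xp; rewrite big1 // => q _; rewrite xp mul0r scale0r.
Qed.

Fact palg_mulDl : left_distributive palg_mul +%R.
Proof.
move=> x y z; pose d := (msupp x `|` msupp y)%fset.
rewrite (@palg_mulw d (msupp z)) ?msuppD_le //.
rewrite (@palg_mulw d (msupp z) x) ?fsubsetUl //.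
rewrite (@palg_mulw d (msupp z) y) ?fsubsetUr //.
rewrite -big_split; apply: eq_bigr => p _; rewrite -big_split; apply: eq_bigr => q _.
by rewrite mcoeffD mulrDl scalerDl.
Qed.

Fact palg_mulDr : right_distributive palg_mul +%R.
Proof.
move=> z x y; pose d := (msupp x `|` msupp y)%fset.
rewrite (@palg_mulw (msupp z) d) ?msuppD_le //.
rewrite (@palg_mulw (msupp z) d z x) ?fsubsetUl //.
rewrite (@palg_mulw (msupp z) d z y) ?fsubsetUr //.
rewrite -big_split; apply: eq_bigr => p _; rewrite -big_split; apply: eq_bigr => q _.
by rewrite mcoeffD mulrDr scalerDl.
Qed.

Fact palg_mulZl k x y : palg_mul (k *: x) y = k *: palg_mul x y.
Proof.
rewrite (@palg_mulw (msupp x) (msupp y)) ?msuppZ_le // palg_mulE scaler_sumr.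
apply: eq_bigr => p _; rewrite scaler_sumr; apply: eq_bigr => q _.
by rewrite mcoeffZ scalerA mulrA.
Qed.

Fact palg_mulZr k x y : palg_mul x (k *: y) = k *: palg_mul x y.
Proof.
rewrite (@palg_mulw (msupp x) (msupp y)) ?msuppZ_le // palg_mulE scaler_sumr.
apply: eq_bigr => p _; rewrite scaler_sumr; apply: eq_bigr => q _.
by rewrite mcoeffZ scalerA mulrCA.
Qed.

Lemma palg_mul_path p q : palg_mul (pathA p) (pathA q) = opathA (pathM p q).
Proof.
rewrite (@palg_mulw [fset p]%fset [fset q]%fset) ?pathAE ?msuppU_le //.
by rewrite !big_seq_fset1 -!pathAE !pathA_coef !eqxx mulr1 scale1r.
Qed.

Fact palg_mul0l y : palg_mul 0 y = 0.
Proof. by have := palg_mulZl 0 0 y; rewrite !scale0r. Qed.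

Fact palg_mul0r x : palg_mul x 0 = 0.
Proof. by have := palg_mulZr 0 x 0; rewrite !scale0r. Qed.

Lemma palg_mul_suml I (r : seq I) (P : pred I) (F : I -> path_algebra) y :
  palg_mul (\sum_(i <- r | P i) F i) y = \sum_(i <- r | P i) palg_mul (F i) y.
Proof.
exact: (big_morph (palg_mul^~ y) (fun a b => palg_mulDl a b y) (palg_mul0l y)).
Qed.

Lemma palg_mul_sumr I (r : seq I) (P : pred I) (F : I -> path_algebra) x :
  palg_mul x (\sum_(i <- r | P i) F i) = \sum_(i <- r | P i) palg_mul x (F i).
Proof.
exact: (big_morph (palg_mul x) (fun a b => palg_mulDr x a b) (palg_mul0r x)).
Qed.

Lemma palg_mul_opathl o q :
  palg_mul (opathA o) (pathA q) = opathA (obind (fun p => pathM p q) o).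
Proof. by case: o => [p|] /=; [exact: palg_mul_path | exact: palg_mul0l]. Qed.

Lemma palg_mul_opathr p o :
  palg_mul (pathA p) (opathA o) = opathA (obind (pathM p) o).
Proof. by case: o => [q|] /=; [exact: palg_mul_path | exact: palg_mul0r]. Qed.

Lemma lin_path_ext (f g : path_algebra -> path_algebra) :
  {morph f : x y / x + y} -> (forall k x, f (k *: x) = k *: f x) ->
  {morph g : x y / x + y} -> (forall k x, g (k *: x) = k *: g x) ->
  (forall p, f (pathA p) = g (pathA p)) -> f =1 g.
Proof.
move=> fD fZ gD gZ fg x.
have f0 : f 0 = 0 by have := fZ 0 0; rewrite !scale0r.
have g0 : g 0 = 0 by have := gZ 0 0; rewrite !scale0r.
rewrite [x]path_algebraE (big_morph f fD f0) (big_morph g gD g0).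
by apply: eq_bigr => p _; rewrite fZ gZ fg.
Qed.

Fact palg_mulA : associative palg_mul.
Proof.
move=> x y z.
apply: (lin_path_ext (f := fun u => palg_mul u (palg_mul y z))
  (g := fun u => palg_mul (palg_mul u y) z)) => [u v|k u|u v|k u|p] /=.
- exact: palg_mulDl.
- exact: palg_mulZl.
- by rewrite (palg_mulDl u v y) (palg_mulDl _ _ z).
- by rewrite (palg_mulZl k u y) (palg_mulZl k _ z).
apply: (lin_path_ext (f := fun u => palg_mul (pathA p) (palg_mul u z))
  (g := fun u => palg_mul (palg_mul (pathA p) u) z)) => [u v|k u|u v|k u|q] /=.
- by rewrite (palg_mulDl u v z) (palg_mulDr (pathA p) _ _).
- by rewrite (palg_mulZl k u z) (palg_mulZr k (pathA p) _).
- by rewrite (palg_mulDr (pathA p) u v) (palg_mulDl _ _ z).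
- by rewrite (palg_mulZr k (pathA p) u) (palg_mulZl k _ z).
apply: (lin_path_ext (f := fun u => palg_mul (pathA p) (palg_mul (pathA q) u))
  (g := fun u => palg_mul (palg_mul (pathA p) (pathA q)) u))
  => [u v|k u|u v|k u|r] /=.
- by rewrite (palg_mulDr (pathA q) u v) (palg_mulDr (pathA p) _ _).
- by rewrite (palg_mulZr k (pathA q) u) (palg_mulZr k (pathA p) _).
- exact: palg_mulDr.
- exact: palg_mulZr.
rewrite (palg_mul_path q r) (palg_mul_path p q).
by rewrite palg_mul_opathr palg_mul_opathl pathMA.
Qed.

Fact palg_mul1l : left_id palg_one palg_mul.
Proof.
move=> x; rewrite [in LHS](path_algebraE x) palg_mul_sumr [RHS]path_algebraE.
apply: eq_bigr => p _; rewrite palg_mulZr; congr (_ *: _).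
rewrite palg_mul_suml (bigD1 (path_end p)) //= palg_mul_path pathM_triv_l eqxx.
rewrite big1 ?addr0 // => i ne.
by rewrite palg_mul_path pathM_triv_l eq_sym (negPf ne).
Qed.

Fact palg_mul1r : right_id palg_one palg_mul.
Proof.
move=> x; rewrite [in LHS](path_algebraE x) palg_mul_suml [RHS]path_algebraE.
apply: eq_bigr => p _; rewrite palg_mulZl; congr (_ *: _).
rewrite palg_mul_sumr (bigD1 (path_start p)) //= palg_mul_path pathM_triv_r eqxx.
rewrite big1 ?addr0 // => i ne.
by rewrite palg_mul_path pathM_triv_r (negPf ne).
Qed.

Lemma palg_one_triv i : palg_one@_(triv_path i) = 1.
Proof.
rewrite /palg_one raddf_sum (bigD1 i) //= pathA_coef eqxx big1 ?addr0 // => j.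
rewrite pathA_coef => ne; case: eqP => // e; case/eqP: ne.
exact: (congr1 (@path_start G) e).
Qed.

Fact palg_one_neq0 : palg_one != 0.
Proof.
apply/eqP => h; case/card_gt0P: (vertex_gt0 G) => i _.
by have /eqP := palg_one_triv i; rewrite h mcoeff0 eq_sym oner_eq0.
Qed.

HB.instance Definition _ := GRing.Zmodule_isNzRing.Build path_algebra
  palg_mulA palg_mul1l palg_mul1r palg_mulDl palg_mulDr palg_one_neq0.

Fact palg_scaleAl (k : K) (x y : path_algebra) : k *: (x * y) = (k *: x) * y.
Proof. exact/esym/palg_mulZl. Qed.

Fact palg_scaleAr (k : K) (x y : path_algebra) : k *: (x * y) = x * (k *: y).
Proof. exact/esym/palg_mulZr. Qed.

HB.instance Definition _ := GRing.Lmodule_isLalgebra.Build K path_algebra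
  palg_scaleAl.
HB.instance Definition _ := GRing.Lalgebra_isAlgebra.Build K path_algebra
  palg_scaleAr.

Lemma pathA_mul p q : pathA p * pathA q = opathA (pathM p q).
Proof. exact: palg_mul_path. Qed.

Definition is_relation (x : path_algebra) : Prop :=
  exists i j : vertex G, forall p, p \in msupp x ->
    [/\ (2 <= path_length p)%N, path_start p = i & path_end p = j].

Record relations := Relations {
  rel_set :> path_algebra -> Prop;
  rel_setP : forall x, rel_set x -> is_relation x
}.

Lemma mul_triv_coef0 (x y : path_algebra) :
  (forall i, x@_(triv_path i) = 0) \/ (forall i, y@_(triv_path i) = 0) ->
  forall i, (x * y)@_(triv_path i) = 0.
Proof.
move=> h i; have -> : x * y = palg_mul x y by [].
rewrite palg_mulE raddf_sum /= big1 // => p _.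
rewrite raddf_sum /= big1 // => q _; rewrite mcoeffZ.
case e: (pathM p q) => [r|] /=; last by rewrite mcoeff0 mulr0.
rewrite pathA_coef; case: eqP => [er|_]; last by rewrite mulr0.
case/pathM_some: e => _ _; rewrite er /= => /esym.
have triv (u : qpath G) : path_arrows u = [::] -> u = triv_path (path_start u).
  by move=> hu; apply: path_inj.
move=> hpq; have hq : path_arrows q = [::].
  by move: hpq; case: (path_arrows q).
have hp : path_arrows p = [::] by rewrite hq in hpq.
by case: h => h; [rewrite (triv p hp) | rewrite (triv q hq)];
  rewrite h ?mul0r ?mulr0 ?mul0r.
Qed.

Fact relations_proper (rho : relations) : ~ gen_ideal rho 1.
Proof.
suff h x : gen_ideal rho x -> forall i, x@_(triv_path i) = 0.
  case/card_gt0P: (vertex_gt0 G) => i _ /h/(_ i).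
  by move/(etrans (esym (palg_one_triv i)))/eqP; rewrite oner_eq0.
elim=> [|u v _ hu _ hv|a r b /rel_setP[j [k hr]]] i.
- exact: mcoeff0.
- by rewrite mcoeffD hu hv addr0.
- apply: mul_triv_coef0; left; apply: mul_triv_coef0; right => l.
  by apply/eqP; rewrite mcoeff_eq0; apply/negP => /hr[].
Qed.

Definition bound_path_algebra (rho : relations) : algType K :=
  quot_alg (@relations_proper rho).

End PathAlgebra.

Definition has_oriented_cycle (G : quiver) : Prop :=
  exists p : qpath G, (0 < path_length p)%N /\ path_start p = path_end p.

Section OnePointExtension.
Variables (K : fieldType) (G : quiver).

(* The quiver on Gamma_0 with arrow set the disjoint union of Gamma_1 and its *)
(* starred copy: [inl a] is alpha and [inr a] is alpha-star.                   *)
Definition double_quiver : quiver :=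
  @Quiver (vertex G) (arrow G + arrow G)%type
    (fun b => match b with inl a => source a | inr a => target a end)
    (fun b => match b with inl a => target a | inr a => source a end)
    (vertex_gt0 G).

Fact incl_path_valid (p : qpath G) :
  @is_walk double_quiver (path_start p) (map inl (path_arrows p)).
Proof.
have := path_valid p; rewrite -/(path_start p) -/(path_arrows p).
by elim: (path_arrows p) (path_start p) => //= a w IH i /andP[-> /IH ->].
Qed.

Definition incl_path (p : qpath G) : qpath double_quiver :=
  @QPath double_quiver (path_start p, map inl (path_arrows p))
    (incl_path_valid p).

Lemma star_walk (i : vertex G) (w : seq (arrow G)) : is_walk i w ->
  @is_walk double_quiver (walk_end i w) (rev (map inr w)) /\
  @walk_end double_quiver (walk_end i w) (rev (map inr w)) = i.
Proof.
elim: w i => [|a w IH] i //= /andP[/eqP <- /IH[v e]].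
have -> : walk_end (source a) (a :: w) = walk_end (target a) w by [].
rewrite rev_cons -cats1 is_walk_cat walk_end_cat v e /=.
by rewrite eqxx.
Qed.

Fact star_path_valid (p : qpath G) :
  @is_walk double_quiver (path_end p) (rev (map inr (path_arrows p))).
Proof. by have [] := star_walk (path_valid p). Qed.

Definition star_path (p : qpath G) : qpath double_quiver :=
  @QPath double_quiver (path_end p, rev (map inr (path_arrows p)))
    (star_path_valid p).

Definition lin_ext (f : qpath G -> qpath double_quiver)
    (x : path_algebra K G) : path_algebra K double_quiver :=
  \sum_(p <- msupp x) x@_p *: pathA K (f p).

Definition dbl_arrow (a : arrow G) : path_algebra K double_quiver :=
  pathA K (@arrow_path double_quiver (inl a)).

Definition dbl_star (a : arrow G) : path_algebra K double_quiver :=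
  pathA K (@arrow_path double_quiver (inr a)).

Inductive extension_rel (rho : path_algebra K G -> Prop) :
    path_algebra K double_quiver -> Prop :=
| ext_rho s : rho s -> extension_rel rho (lin_ext incl_path s)
| ext_rho_star s : rho s -> extension_rel rho (lin_ext star_path s)
| ext_arrow_star a b : extension_rel rho (dbl_arrow a * dbl_star b)
| ext_star_arrow a b : extension_rel rho (dbl_star a * dbl_arrow b).

Lemma lin_ext_supp f x q : q \in msupp (lin_ext f x) ->
  exists2 p, p \in msupp x & q = f p.
Proof.
rewrite -mcoeff_neq0 /lin_ext raddf_sum /= big_seq => h.
have /hasP[p hp /eqP ->] : has (fun p => q == f p) (msupp x); last by exists p.
apply/negPn/negP => /hasPn hn; case/eqP: h; apply: big1 => p hp.
by rewrite mcoeffZ pathA_coef eq_sym (negPf (hn p hp)) mulr0.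
Qed.

Lemma arrow_mul_relation (a b : arrow double_quiver) :
  is_relation (pathA K (arrow_path a) * pathA K (arrow_path b)).
Proof.
rewrite pathA_mul; case e: (pathM _ _) => [r|] /=; last first.
  by exists (source a), (source a) => p; rewrite msupp0 in_fset0.
exists (path_start r), (path_end r) => p.
rewrite pathAE msuppU oner_eq0 in_fset1 => /eqP ->; split=> //.
by case/pathM_some: e => _ _; rewrite /path_length => ->.
Qed.

Fact extension_relP (rho : relations K G) x :
  extension_rel rho x -> is_relation x.
Proof.
case=> [s /rel_setP[i [j h]]|s /rel_setP[i [j h]]|a b|a b].
- exists i, j => q /lin_ext_supp[p /h[hl hs he] ->]; split.
  + by rewrite /path_length /path_arrows /= size_map.
  + exact: hs.
  + by rewrite -he /path_end /walk_end /path_arrows /= -map_comp hs -hs.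
- exists j, i => q /lin_ext_supp[p /h[hl hs he] ->]; split.
  + by rewrite /path_length /path_arrows /= size_rev size_map.
  + exact: he.
  + by rewrite -hs; have [_] := star_walk (path_valid p).
- exact: arrow_mul_relation.
- exact: arrow_mul_relation.
Qed.

Definition extension_relations (rho : relations K G) :
    relations K double_quiver :=
  Relations (@extension_relP rho).

Definition one_point_extension (rho : relations K G) : algType K :=
  bound_path_algebra (extension_relations rho).

End OnePointExtension.

(* Main.v *)
(* When no path of Gamma has length 2, every product of two arrows of the     *)
(* doubled quiver vanishes in E(Lambda), which is thus spanned by the         *)
(* vertices e_i and the arrows, none of which is a loop.  The Jordan identity *)
(* on the e_i shows that for m = \sum_i J(e_i) e_i the inner derivation       *)
(* [m, -] agrees with J on the e_i, so T = J - [m, -] is a Jordan derivation  *)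
(* killing them.  For an arrow u = e_i u e_j, applying T to                   *)
(* e_i o u = u = u o e_j gives T u = e_i (T u) e_j + e_j (T u) e_i.  The      *)
(* first components assemble into a derivation and the second ones into an    *)
(* anti-derivation: the product rules only need checking against the e_k, as  *)
(* products of arrows vanish.                                                 *)

Require Import Defs.
From HB Require Import structures.
From mathcomp Require Import all_boot all_algebra.
Import GRing.Theory.
Local Open Scope ring_scope.

(** The argument only uses a Peirce decomposition: idempotents [e i] that are orthogonal and sum to
    [1], with [e i A e i = K e i] and with vanishing products of off-diagonal components. Since char
    K is not 2, the Jordan identity at [(e i, e i)] can be halved. Together with the identity at
    [(e i, e j)], it shows that [J] agrees on every [e i] with one inner derivation ([inner_e]). The
    difference kills every [e i] and maps [e i A e j] into [e i A e j + e j A e i]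
    ([direct_reversed_part]). Its two projections are a derivation and an anti-derivation, because
    the product rules need checking only on idempotents and off-diagonal elements ([peirce_ind]). In
    E(Lambda) the trivial paths are such idempotents, because paths of length at least two vanish
    there ([cls_long_path]). *)

Lemma jordan_idem_eq0 (R : pzRingType) (f u : R) :
  f * f = f -> u = u * f + f * u -> f * u * f = 0.
Proof.
move=> ff /(congr1 (fun v => f * v * f)).
rewrite mulrDr mulrDl !mulrA ff -[_ * f * f]mulrA ff.
by move/eqP; rewrite -subr_eq0 opprD addNKr oppr_eq0 => /eqP.
Qed.

(** * Peirce components relative to the idempotents *)

Section PeirceDecomposition.
Variables (K : fieldType) (A : algType K) (I : finType) (e : I -> A).
Hypothesis two_neq0 : (2%:R : K) != 0.
Hypothesis e_mul : forall i j, e i * e j = (e i) *+ (i == j).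
Hypothesis e_sum : \sum_i e i = 1.
Hypothesis e_diag : forall i x, exists c : K, e i * x * e i = c *: e i.
Hypothesis e_offdiag : forall i j k x y, i != j -> j != k ->
  e i * x * e j * y * e k = 0.

Lemma e_idem i : e i * e i = e i.
Proof. by rewrite e_mul eqxx. Qed.

Lemma e_orth i j : i != j -> e i * e j = 0.
Proof. by rewrite e_mul => /negPf ->. Qed.

Definition peirce i j (x : A) := e i * x * e j.

Lemma peirceD i j x y : peirce i j (x + y) = peirce i j x + peirce i j y.
Proof. by rewrite /peirce mulrDr mulrDl. Qed.

Lemma peirceZ i j c x : peirce i j (c *: x) = c *: peirce i j x.
Proof. by rewrite /peirce -scalerAr -scalerAl. Qed.

Lemma peirce_sum x : x = \sum_i \sum_j peirce i j x.
Proof.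
rewrite -[LHS]mul1r -e_sum mulr_suml; apply: eq_bigr => i _.
by rewrite -mulr_sumr e_sum mulr1.
Qed.

Lemma peirceK i j k l x :
  peirce k l (peirce i j x) = (peirce i j x) *+ ((k == i) && (l == j)).
Proof.
rewrite /peirce !mulrA e_mul -[_ * e j * e l]mulrA e_mul [j == l]eq_sym.
case: eqVneq => [->|_]; last by rewrite !mul0r.
by case: eqVneq => _; rewrite ?mulr0.
Qed.

Lemma peirce_ind (P : A -> Prop) :
  (forall x y, P x -> P y -> P (x + y)) -> (forall c x, P x -> P (c *: x)) ->
  (forall i, P (e i)) ->
  (forall i j u, i != j -> u = peirce i j u -> P u) -> forall x, P x.
Proof.
move=> PD PZ Pe Pu x.
have P0 : P 0.
  (* [I] is nonempty, since an empty family would sum to [0] instead of [1]. *)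
  have [i _|no_e] := pickP I; first by rewrite -(scale0r (e i)); exact: PZ.
  by move/eqP: e_sum; rewrite big_pred0 // eq_sym oner_eq0.
rewrite [x]peirce_sum.
apply: (big_ind P) => // i _; apply: (big_ind P) => // j _.
have [<-|ij] := eqVneq i j; first last.
  by apply: (Pu i j) => //; rewrite peirceK !eqxx.
by rewrite /peirce; have [c ->] := e_diag i x; exact: PZ.
Qed.


Lemma peirce_mul0 i j k l x y :
  i != j -> k != l -> peirce i j x * peirce k l y = 0.
Proof.
move=> ij kl; rewrite /peirce !mulrA -[_ * e j * e k]mulrA e_mul.
case: (eqVneq j k) kl => [<- jl|_ _]; last by rewrite mulr0 !mul0r.
exact: e_offdiag.
Qed.

Lemma mul_e_peirce k i j x : e k * peirce i j x = peirce i j x *+ (k == i).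
Proof.
by rewrite /peirce !mulrA e_mul; case: eqVneq => [->|]; rewrite ?mul0r.
Qed.

Lemma mul_peirce_e k i j x : peirce i j x * e k = peirce i j x *+ (j == k).
Proof.
by rewrite /peirce -!mulrA e_mul; case: eqVneq => // _; rewrite !mulr0.
Qed.

(** * Jordan derivations that kill every idempotent *)

Section VanishingOnIdempotents.
Variable T : {linear A -> A}.
Hypothesis jordanT : is_jordan_derivation T.
Hypothesis T_e : forall i, T (e i) = 0.

Definition direct_part (x : A) : A :=
  \sum_i \sum_j peirce i j (T (peirce i j x)).
Definition reversed_part (x : A) : A :=
  \sum_i \sum_j peirce j i (T (peirce i j x)).

Lemma direct_part_linear : linear direct_part.
Proof.
move=> c x y; rewrite scaler_sumr -big_split; apply: eq_bigr => i _.
rewrite scaler_sumr -big_split; apply: eq_bigr => j _.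
by rewrite peirceD peirceZ linearP peirceD peirceZ.
Qed.

Lemma reversed_part_linear : linear reversed_part.
Proof.
move=> c x y; rewrite scaler_sumr -big_split; apply: eq_bigr => i _.
rewrite scaler_sumr -big_split; apply: eq_bigr => j _.
by rewrite peirceD peirceZ linearP peirceD peirceZ.
Qed.

HB.instance Definition _ :=
  GRing.isLinear.Build K A A *:%R direct_part direct_part_linear.
HB.instance Definition _ :=
  GRing.isLinear.Build K A A *:%R reversed_part reversed_part_linear.

Lemma peirce_sum_homogeneous (F : I -> I -> A -> A) i j u :
  (forall k l, F k l 0 = 0) -> u = peirce i j u ->
  \sum_k \sum_l F k l (peirce k l u) = F i j u.
Proof.
move=> F0 uE; rewrite (bigD1 i) //= (bigD1 j) //= -uE.
rewrite big1 => [|l lj]; last first.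
  by rewrite uE peirceK (negPf lj) andbF F0.
rewrite big1 => [|k ki]; first by rewrite !addr0.
by rewrite big1 // => l _; rewrite uE peirceK (negPf ki) F0.
Qed.

Lemma direct_partE i j u :
  u = peirce i j u -> direct_part u = peirce i j (T u).
Proof.
apply: (peirce_sum_homogeneous (fun k l x => peirce k l (T x))) => k l.
by rewrite linear0 /peirce mulr0 mul0r.
Qed.

Lemma reversed_partE i j u :
  u = peirce i j u -> reversed_part u = peirce j i (T u).
Proof.
apply: (peirce_sum_homogeneous (fun k l x => peirce l k (T x))) => k l.
by rewrite linear0 /peirce mulr0 mul0r.
Qed.

Lemma direct_part_e i : direct_part (e i) = 0.
Proof. by rewrite (direct_partE i i) ?T_e /peirce ?e_idem // mulr0 mul0r. Qed.

Lemma reversed_part_e i : reversed_part (e i) = 0.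
Proof. by rewrite (reversed_partE i i) ?T_e /peirce ?e_idem // mulr0 mul0r. Qed.

(** As [direct_part] kills the [e i] and preserves Peirce positions, it commutes with multiplication
    by them on either side. On two off-diagonal elements all three products vanish. *)
Lemma direct_part_derivation a b :
  direct_part (a * b) = direct_part a * b + a * direct_part b.
Proof.
move: b; elim/peirce_ind: a => [a b IHa IHb y|c a IH y|i|i j u ij uE y].
- by rewrite mulrDl !linearD /= IHa IHb !mulrDl addrACA.
- by rewrite -scalerAl !linearZ /= IH scalerDr !scalerAl.
- elim/peirce_ind => [a b IHa IHb|c a IH|k|k l v kl vE].
  + by rewrite mulrDr !linearD /= IHa IHb !mulrDr addrACA.
  + by rewrite -scalerAr !linearZ /= IH scalerDr !scalerAr.
  + by rewrite e_mul raddfMn /= !direct_part_e mul0rn mul0r mulr0 addr0.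
  + rewrite direct_part_e mul0r add0r vE mul_e_peirce -vE raddfMn /=.
    by rewrite (direct_partE _ _ _ vE) mul_e_peirce.
elim/peirce_ind: y => [a b IHa IHb|c a IH|k|k l v kl vE].
- by rewrite mulrDr !linearD /= IHa IHb !mulrDr addrACA.
- by rewrite -scalerAr !linearZ /= IH scalerDr !scalerAr.
- rewrite direct_part_e mulr0 addr0 uE mul_peirce_e -uE raddfMn /=.
  by rewrite (direct_partE _ _ _ uE) mul_peirce_e.
- rewrite (direct_partE _ _ _ uE) (direct_partE _ _ _ vE) uE vE.
  by rewrite !peirce_mul0 // linear0 addr0.
Qed.

(** Transposing the Peirce position turns left multiplication by [e k] into right multiplication and
    keeps off-diagonal elements off-diagonal. *)
Lemma reversed_part_antiderivation a b :
  reversed_part (a * b) = reversed_part b * a + b * reversed_part a.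
Proof.
move: b; elim/peirce_ind: a => [a b IHa IHb y|c a IH y|i|i j u ij uE y].
- by rewrite mulrDl !linearD /= IHa IHb !mulrDr addrACA.
- by rewrite -scalerAl !linearZ /= IH scalerDr !scalerAr.
- elim/peirce_ind => [a b IHa IHb|c a IH|k|k l v kl vE].
  + by rewrite mulrDr !linearD /= IHa IHb !mulrDl addrACA.
  + by rewrite -scalerAr !linearZ /= IH scalerDr !scalerAl.
  + by rewrite e_mul raddfMn /= !reversed_part_e mul0rn mul0r mulr0 addr0.
  + rewrite reversed_part_e mulr0 addr0 vE mul_e_peirce -vE raddfMn /=.
    by rewrite (reversed_partE _ _ _ vE) mul_peirce_e eq_sym.
elim/peirce_ind: y => [a b IHa IHb|c a IH|k|k l v kl vE].
- by rewrite mulrDr !linearD /= IHa IHb !mulrDl addrACA.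
- by rewrite -scalerAr !linearZ /= IH scalerDr !scalerAl.
- rewrite reversed_part_e mul0r add0r uE mul_peirce_e -uE raddfMn /=.
  by rewrite (reversed_partE _ _ _ uE) mul_e_peirce eq_sym.
- rewrite (reversed_partE _ _ _ uE) (reversed_partE _ _ _ vE) uE vE.
  by rewrite !peirce_mul0 // 1?eq_sym // linear0 addr0.
Qed.

Lemma direct_reversed_part x : T x = direct_part x + reversed_part x.
Proof.
elim/peirce_ind: x => [a b IHa IHb|c a IH|i|i j u ij uE].
- by rewrite !linearD /= IHa IHb addrACA.
- by rewrite !linearZ /= IH -scalerDr.
- by rewrite T_e direct_part_e reversed_part_e addr0.
rewrite (direct_partE _ _ _ uE) (reversed_partE _ _ _ uE).
have iu : jordan_mul (e i) u = u.
  rewrite /jordan_mul uE mul_e_peirce mul_peirce_e eqxx.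
  by rewrite [j == i]eq_sym (negPf ij) addr0.
have uj : jordan_mul u (e j) = u.
  rewrite /jordan_mul uE mul_e_peirce mul_peirce_e eqxx.
  by rewrite [j == i]eq_sym (negPf ij) addr0.
have := jordanT (e i) u; have := jordanT u (e j).
rewrite iu uj !T_e /jordan_mul.
rewrite !(mulr0, mul0r, addr0, add0r); move: (T u) => w wj wi.
(* Substituting [wj] for [w] in both terms of [wi] leaves one Peirce component from each, by
   orthogonality of [e i] and [e j]. *)
have ew : e i * w = peirce i j w.
  by rewrite {1}wj mulrDr [e i * (e j * w)]mulrA e_orth // mul0r addr0 mulrA.
have we : w * e i = peirce j i w.
  by rewrite {1}wj mulrDl -mulrA [e j * e i]e_orth 1?eq_sym // mulr0 add0r.
by rewrite {1}wi ew we.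
Qed.

End VanishingOnIdempotents.

(** * Subtracting an inner derivation *)

Variable J : {linear A -> A}.
Hypothesis jordanJ : is_jordan_derivation J.

Definition inner_elt : A := \sum_i J (e i) * e i.

Definition inner (x : A) : A := inner_elt * x - x * inner_elt.

Lemma inner_linear : linear inner.
Proof.
move=> c x y; rewrite /inner mulrDr mulrDl -scalerAr -scalerAl opprD addrACA.
by rewrite -scalerBr.
Qed.

HB.instance Definition _ := GRing.isLinear.Build K A A *:%R inner inner_linear.

Lemma inner_derivation a b : inner (a * b) = inner a * b + a * inner b.
Proof. by rewrite /inner mulrBl mulrBr !mulrA subrKA. Qed.

Lemma derivation_jordan (D : {linear A -> A}) :
  is_derivation D -> is_jordan_derivation D.
Proof.
move=> DM a b; rewrite /jordan_mul linearD !DM -!addrA; congr (_ + _).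
by rewrite addrA addrC.
Qed.

Lemma jordan_mulBl (u v w : A) :
  jordan_mul (u - v) w = jordan_mul u w - jordan_mul v w.
Proof. by rewrite /jordan_mul mulrBl mulrBr opprD addrACA. Qed.

Lemma jordan_mulBr (u v w : A) :
  jordan_mul u (v - w) = jordan_mul u v - jordan_mul u w.
Proof. by rewrite /jordan_mul mulrBl mulrBr opprD addrACA. Qed.

Lemma J_e_split i : J (e i) = J (e i) * e i + e i * J (e i).
Proof.
have /= := jordanJ (e i) (e i); rewrite /jordan_mul e_idem linearD.
rewrite [e i * _ + _]addrC -!mulr2n -!scaler_nat => h.
exact: (scalerI two_neq0 h).
Qed.

Lemma peirce_J_diag i : peirce i i (J (e i)) = 0.
Proof. by apply: jordan_idem_eq0; [exact: e_idem | exact: J_e_split]. Qed.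

(** This is the [(i, j)] component of the Jordan identity applied to the zero product of [e i] and
    [e j]. *)
Lemma peirce_J_opp i j :
  i != j -> peirce i j (J (e j)) = - peirce i j (J (e i)).
Proof.
move=> ij; apply/eqP; rewrite -addr_eq0 -peirceD addrC.
have := jordanJ (e i) (e j).
rewrite /jordan_mul !e_orth 1?[j == i]eq_sym // addr0 linear0.
move/(congr1 (peirce i j)); rewrite {1}/peirce mulr0 mul0r !peirceD /peirce.
rewrite !mulrA (e_orth _ _ ij) !mul0r addr0 e_idem.
rewrite -!mulrA (e_orth _ _ ij) e_idem !mulr0 addr0.
by rewrite !mulrA => <-.
Qed.

(** Right multiplication of [inner_elt] by [e i] leaves [J (e i) * e i]. Left multiplication gives
    [- e i * J (e i)], by [peirce_J_opp] off the diagonal and [peirce_J_diag] on it. [J_e_split]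
    then concludes. *)
Lemma inner_e i : inner (e i) = J (e i).
Proof.
rewrite /inner /inner_elt mulr_suml (bigD1 i) //= big1 => [|j ji]; last first.
  by rewrite -mulrA e_orth // mulr0.
rewrite addr0 -mulrA e_idem mulr_sumr [RHS]J_e_split -sumrN; congr (_ + _).
rewrite -[RHS]mulr1 -e_sum mulr_sumr; apply: eq_bigr => j _; rewrite mulrA.
rewrite -!/(peirce _ _ _); have [<-|ij] := eqVneq i j.
  by rewrite peirce_J_diag oppr0.
by rewrite peirce_J_opp // opprK.
Qed.

Definition normalized_J (x : A) : A := J x - inner x.

Lemma normalized_J_linear : linear normalized_J.
Proof.
by move=> c x y; rewrite /normalized_J !linearP /= addrACA -scalerDr.
Qed.

HB.instance Definition _ :=
  GRing.isLinear.Build K A A *:%R normalized_J normalized_J_linear.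

Lemma normalized_J_jordan : is_jordan_derivation normalized_J.
Proof.
move=> a b; rewrite /= /normalized_J jordanJ.
rewrite (derivation_jordan inner inner_derivation) /=.
by rewrite (jordan_mulBl (J a)) (jordan_mulBr _ (J b)) opprD addrACA.
Qed.

Lemma normalized_J_e i : normalized_J (e i) = 0.
Proof. by rewrite /normalized_J inner_e subrr. Qed.

Definition derivation_part (x : A) : A := inner x + direct_part normalized_J x.

Lemma derivation_part_linear : linear derivation_part.
Proof.
by move=> c x y; rewrite /derivation_part !linearP /= addrACA -scalerDr.
Qed.

HB.instance Definition _ :=
  GRing.isLinear.Build K A A *:%R derivation_part derivation_part_linear.

Lemma jordan_derivation_decomposition :
  exists D B : {linear A -> A},
    [/\ is_derivation D, is_antiderivation B & forall x, J x = D x + B x].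
Proof.
exists derivation_part, (reversed_part normalized_J); split=> [a b|a b|x].
- rewrite /= /derivation_part inner_derivation.
  rewrite (direct_part_derivation _ normalized_J_e).
  by rewrite (mulrDl (inner a)) (mulrDr _ (inner b)) addrACA.
- exact: (reversed_part_antiderivation _ normalized_J_e).
- rewrite /= /derivation_part -addrA.
  rewrite -(direct_reversed_part _ normalized_J_jordan normalized_J_e).
  by rewrite /= /normalized_J addrC subrK.
Qed.

End PeirceDecomposition.

(** * Trivial paths as Peirce idempotents of E(Lambda) *)

Section RadicalSquareZero.
Variables (K : fieldType) (G : quiver) (rho : relations K G).
Hypothesis short : ~ exists p : qpath G, (1 < path_length p)%N.

Local Notation QQ := (double_quiver G).

(* [cls] stands for the quotient map onto the one-point extension; it is kept *)
(* abstract because comparing scaled elements of the concrete quotient by     *)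
(* conversion does not terminate in practice.                                 *)
Variables (E : algType K) (cls : path_algebra K QQ -> E).
Hypothesis clsM : {morph cls : x y / x * y}.
Hypothesis clsD : {morph cls : x y / x + y}.
Hypothesis clsZ : forall c, {morph cls : x / c *: x}.
Hypothesis cls1 : cls 1 = 1.
Hypothesis cls_surj : forall y, exists x, y = cls x.
Hypothesis cls_rel : forall x, extension_rel rho x -> cls x = 0.

Lemma cls0 : cls 0 = 0.
Proof. by rewrite -(scale0r 0) clsZ scale0r. Qed.

Lemma no_composable (a b : arrow G) : target a <> source b.
Proof.
move=> ab; case: short.
have v : is_walk (source a) [:: a; b] by rewrite /= ab !eqxx.
by exists (@QPath G (source a, [:: a; b]) v).
Qed.

(** A loop could be composed with itself into a path of length two. *)
Lemma no_loop (a : arrow QQ) : target a <> source a.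
Proof. by case: a => a /=; [|move/esym]; exact: no_composable. Qed.

(** Mixed products are defining relations. Two plain or two starred arrows never compose, since
    Gamma has no path of length two. *)
Lemma arrow_mul_eq0 (a b : arrow QQ) :
  cls (pathA K (arrow_path b) * pathA K (arrow_path a)) = 0.
Proof.
case: a b => [a|a] [b|b]; try by apply: cls_rel; constructor.
  by rewrite pathA_mul pathM_none ?cls0 //; exact: no_composable.
rewrite pathA_mul pathM_none ?cls0 //.
by move=> /esym; exact: no_composable.
Qed.

(** The first two arrows of the path split off as a right factor, which is already zero. *)
Lemma cls_long_path (q : qpath QQ) :
  (2 <= path_length q)%N -> cls (pathA K q) = 0.
Proof.
case: q => [[i [|a [|b w]]]] //= v _.
have /and3P[/eqP ai /eqP ab vw] := v.
pose r := @QPath QQ (target b, w) vw.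
have v2 : @is_walk QQ (source a) [:: a; b] by rewrite /= ab !eqxx.
pose ba := @QPath QQ (source a, [:: a; b]) v2.
have Eba : pathA K (arrow_path b) * pathA K (arrow_path a) = pathA K ba.
  rewrite pathA_mul (_ : pathM _ _ = Some ba) //; apply/pathM_some; split=> //.
pose q := @QPath QQ (i, [:: a, b & w]) v.
rewrite -/q; have -> : pathA K q = pathA K r * pathA K ba.
  rewrite pathA_mul (_ : pathM _ _ = Some q) //; apply/pathM_some.
  by split=> //; rewrite /path_start /= ai.
by rewrite -Eba clsM arrow_mul_eq0 mulr0.
Qed.

Definition vtx i : E := cls (pathA K (@triv_path QQ i)).

Lemma cls_ind (P : E -> Prop) :
  (forall x y, P x -> P y -> P (x + y)) -> (forall c x, P x -> P (c *: x)) ->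
  (forall p, P (cls (pathA K p))) -> forall x, P x.
Proof.
move=> PD PZ Pp y; have [x ->] := cls_surj y; rewrite [x]path_algebraE {y}.
apply: (big_ind (fun x => P (cls x))) => [|y z|p _].
- case/card_gt0P: (vertex_gt0 G) => i _.
  by rewrite -(scale0r (pathA K (@triv_path QQ i))) clsZ; exact: PZ.
- by rewrite clsD; exact: PD.
- by rewrite clsZ; exact: PZ.
Qed.

Lemma vtx_path_vtx i j p : vtx i * cls (pathA K p) * vtx j =
  if (path_end p == i) && (j == path_start p) then cls (pathA K p) else 0.
Proof.
rewrite /vtx -!clsM pathA_mul pathM_triv_l.
case: (path_end p == i) => /=; last by rewrite mul0r cls0.
rewrite pathA_mul pathM_triv_r; case: (j == _) => //=; exact: cls0.
Qed.

Lemma vtx_mul i j : vtx i * vtx j = vtx i *+ (i == j).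
Proof.
rewrite /vtx -clsM pathA_mul pathM_triv_r /= eq_sym.
by case: eqP => _ //=; rewrite cls0.
Qed.

Lemma vtx_sum : \sum_i vtx i = 1.
Proof. by rewrite -cls1 -(big_morph cls clsD cls0). Qed.

(** Among the paths from [i] to [i], long ones vanish and those of length one would be loops, so
    only the trivial path contributes. *)
Lemma vtx_diag i x : exists c : K, vtx i * x * vtx i = c *: vtx i.
Proof.
elim/cls_ind: x => [x y [c IHx] [d IHy]|c x [d IH]|p].
- by exists (c + d); rewrite mulrDr mulrDl IHx IHy scalerDl.
- by exists (c * d); rewrite -scalerAr -!scalerAl IH scalerA.
rewrite vtx_path_vtx; case: andP => [[/eqP pe /eqP ps]|_]; last first.
  by exists 0; rewrite scale0r.
have [/cls_long_path ->|] := leqP 2 (path_length p).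
  by exists 0; rewrite scale0r.
case: p pe ps => [[k [|a [|b w]]] v] //= pe ps _.
  exists 1; rewrite scale1r /vtx; congr (cls (pathA K _)).
  exact: path_inj.
have /andP[/eqP sa _] := v.
by case: (no_loop a); rewrite [RHS]sa -[RHS]ps; exact: pe.
Qed.

(** A path between distinct vertices has positive length, so a composite of two such paths has
    length at least two. *)
Lemma vtx_offdiag i j k x y : i != j -> j != k ->
  vtx i * x * vtx j * y * vtx k = 0.
Proof.
move=> ij jk; elim/cls_ind: x => [a b IHa IHb|c a IH|p].
- by rewrite mulrDr !mulrDl IHa IHb addr0.
- by rewrite -scalerAr -!scalerAl IH scaler0.
elim/cls_ind: y => [a b IHa IHb|c a IH|q].
- by rewrite mulrDr !mulrDl IHa IHb addr0.
- by rewrite -scalerAr -!scalerAl IH scaler0.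
(* Doubling [vtx j] encloses each path in its own pair of idempotents. *)
have vv : vtx j * vtx j = vtx j by rewrite vtx_mul eqxx.
rewrite -vv !mulrA -2!mulrA [vtx j * _]mulrA !vtx_path_vtx.
case: andP => [[/eqP pe /eqP ps]|_]; last by rewrite mul0r.
case: andP => [[/eqP qe /eqP qs]|_]; last by rewrite mulr0.
have pos (r : qpath QQ) : path_end r != path_start r -> (0 < path_length r)%N.
  by case: r => [[l [|a w]] v] //=; rewrite /path_end /path_start /= eqxx.
rewrite -clsM pathA_mul; case pq: (pathM p q) => [r|] /=; last exact: cls0.
apply: cls_long_path; have [_ _] := (pathM_some _ _ _).1 pq.
rewrite /path_length => ->; rewrite size_cat -addn1 addnC.
by apply: leq_add; apply: pos; rewrite ?pe ?qe -?ps -?qs.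
Qed.

Lemma rad_sqr0_decomposition (J : {linear E -> E}) :
  (2%:R : K) != 0 -> is_jordan_derivation J ->
  exists D B : {linear E -> E},
    [/\ is_derivation D, is_antiderivation B & forall x, J x = D x + B x].
Proof.
move=> two_neq0; apply: (jordan_derivation_decomposition _ _ _ vtx) => //.
- exact: vtx_mul.
- exact: vtx_sum.
- exact: vtx_diag.
- exact: vtx_offdiag.
Qed.

End RadicalSquareZero.

Theorem theorem4p6 (K : fieldType) (charK : 2%N \notin [pchar K])
    (G : quiver) (acyclic : ~ has_oriented_cycle G)
    (card_vertex : (2 <= #|vertex G|)%N)
    (rho : relations K G)
    (short : ~ exists p : qpath G, (1 < path_length p)%N)
    (J : {linear one_point_extension rho -> one_point_extension rho}) :
  is_jordan_derivation J ->
  exists D A : {linear one_point_extension rho -> one_point_extension rho},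
    [/\ is_derivation D, is_antiderivation A & forall x, J x = D x + A x].
Proof.
have two_neq0 : (2%:R : K) != 0 by move: charK; rewrite inE.
pose cls : path_algebra K (double_quiver G) -> one_point_extension rho :=
  quot_pi (@relations_proper _ _ (extension_relations rho)).
have clsM : {morph cls : x y / x * y} by exact: quot_piM.
have clsD : {morph cls : x y / x + y} by exact: raddfD.
have clsZ c : {morph cls : x / c *: x} by exact: quot_piZ.
have cls1 : cls 1 = 1 by exact: quot_pi1.
have cls_surj y : exists x, y = cls x.
  by exists (quot_repr y); rewrite /cls quot_reprK.
have cls_rel x : extension_rel rho x -> cls x = 0.
  move=> rx; rewrite -[RHS](raddf0 (quot_pi _)); apply/quot_piP.
  by rewrite subr0; exact: gen_ideal_sub.
exact: (rad_sqr0_decomposition _ _ _ short _ _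
  clsM clsD clsZ cls1 cls_surj cls_rel J two_neq0).
Qed.
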